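(* Let $n\ge 1$ and $\delta\in(0,n]$. Suppose that a function $f\in\mathrm{N}L^1(\mathbb{R}^n,\tilde{\mathcal H}^\delta_\infty)$ is an $\mathrm{N}L^1$-limit of continuous functions. Then $$\limsup_{r\to0^+}\frac{1}{\tilde{\mathcal H}^\delta_\infty(B(x,r))}\int_{B(x,r)}|f(y)-f(x)|\,d\tilde{\mathcal H}^\delta_\infty(y)=0$$ for $\tilde{\mathcal H}^\delta_\infty$-almost every $x\in\mathbb{R}^n$. If $f$ is also non-negative, then $$f(x)=\limsup_{r\to0^+}\frac{1}{\tilde{\mathcal H}^\delta_\infty(B(x,r))}\int_{B(x,r)}f(y)\,d\tilde{\mathcal H}^\delta_\infty(y)$$ for $\tilde{\mathcal H}^\delta_\infty$-almost every $x\in\mathbb{R}^n$.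
   Context: Dyadic cubes: for $k\in\mathbb{Z}$ let $\mathcal Q_k$ be the collection of half-open cubes $Q$ with vertices in the lattice $(2^k\mathbb{Z})^n$, each a translate of $[0,2^k)^n$; its side length is $\ell(Q)=2^k$. Dyadic cubes are the elements of $\bigcup_{k\in\mathbb{Z}}\mathcal Q_k$. Dyadic Hausdorff content: for $\delta\in(0,n]$ and any $E\subset\mathbb{R}^n$, $\tilde{\mathcal H}^\delta_\infty(E):=\inf\{\sum_{i}\ell(Q_i)^\delta : E\subset \operatorname{int}(\bigcup_{i}Q_i)\}$, the infimum being over all countable (or finite) collections of dyadic cubes $Q_i$. Choquet integral: for any set $\Omega\subset\mathbb{R}^n$ and any function $f:\Omega\to[0,\infty]$ (no measurability required), $\int_\Omega f\,d\tilde{\mathcal H}^\delta_\infty:=\int_0^\infty\tilde{\mathcal H}^\delta_\infty(\{x\in\Omega: f(x)>t\})\,dt$. $\mathrm{N}L^1(\Omega,\tilde{\mathcal H}^\delta_\infty)$ is the set of all (possibly non-measurable) functions $f:\Omega\to[-\infty,\infty]$ with $\int_\Omega|f|\,d\tilde{\mathcal H}^\delta_\infty<\infty$, functions coinciding outside a set of zero $\tilde{\mathcal H}^\delta_\infty$-content being identified. A function $f\in\mathrm{N}L^1(\mathbb{R}^n,\tilde{\mathcal H}^\delta_\infty)$ is an $\mathrm{N}L^1$-limit of continuous functions if there is a sequence of continuous functions $\phi_i:\mathbb{R}^n\to\mathbb{R}$ such that $\int_{\mathbb{R}^n}|f-\phi_i|\,d\tilde{\mathcal H}^\delta_\infty\to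 0$ as $i\to\infty$. ''For $\tilde{\mathcal H}^\delta_\infty$-almost every $x$'' means outside a set $E$ with $\tilde{\mathcal H}^\delta_\infty(E)=0$. $B(x,r)$ is the open ball with centre $x$ and radius $r$. *)

(* Defs.v *)
(* MathComp-Analysis, over an arbitrary R : realType; R^n is 'rV[R]_n with its
   canonical (product) topology. *)
From mathcomp Require Export all_boot all_order all_algebra.
From mathcomp Require Export all_classical all_reals all_analysis.
Export Order.TTheory GRing.Theory Num.Theory.
Export numFieldNormedType.Exports.

#[export] Set Implicit Arguments.
#[export] Unset Strict Implicit.
#[export] Unset Printing Implicit Defensive.

#[global] Open Scope classical_set_scope.
#[global] Open Scope ring_scope.

(* The pair (k, m) stands for the cube 2^k m + [0, 2^k)^n; for n >= 1 distinct
   pairs give distinct cubes. *)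
Notation dyadic n := (int * 'rV[int]_n)%type.

Definition side (R : realType) (n : nat) (q : dyadic n) : R := 2 ^ q.1.

Definition cube (R : realType) (n : nat) (q : dyadic n) : set 'rV[R]_n :=
  [set x | forall i : 'I_n,
     (q.2 ord0 i)%:~R * side R q <= x ord0 i < (q.2 ord0 i + 1)%:~R * side R q].

(* A collection of dyadic cubes is a set D of indices. It is finite or countable,
   since dyadic n is a countType. *)
Definition content (R : realType) (n : nat) (delta : R) (E : set 'rV[R]_n) : \bar R :=
  ereal_inf [set (\esum_(q in D) (side R q `^ delta)%:E)%E
            | D in [set D : set (dyadic n) |
                     E `<=` interior (\bigcup_(q in D) cube q)]].

(* Meaningful for f nonnegative on Omega; only the values of f on Omega matter.
   The integrand is a nonincreasing function of t, whatever f is. *)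
Definition choquet (R : realType) (n : nat) (delta : R) (Omega : set 'rV[R]_n)
    (f : 'rV[R]_n -> \bar R) : \bar R :=
  (\int[lebesgue_measure]_(t in `[0%R, +oo[)
     content delta [set x | Omega x /\ t%:E < f x])%E.

(* The elements of NL^1 are represented by functions defined everywhere. *)
Definition NL1 (R : realType) (n : nat) (delta : R) (Omega : set 'rV[R]_n) :
    set ('rV[R]_n -> \bar R) :=
  [set f | (choquet delta Omega (fun x => `|f x|) < +oo)%E].

Definition NL1_limit_of_continuous (R : realType) (n : nat) (delta : R)
    (f : 'rV[R]_n -> \bar R) : Prop :=
  exists phi : nat -> 'rV[R]_n -> R,
    (forall i, continuous (phi i)) /\
    ((choquet delta setT (fun x => `|f x - (phi i x)%:E|))%E @[i --> \oo] --> 0%E).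

Definition content_ae (R : realType) (n : nat) (delta : R)
    (P : 'rV[R]_n -> Prop) : Prop :=
  exists E : set 'rV[R]_n, content delta E = 0%E /\ forall x, ~ E x -> P x.

(* Euclidean, unlike the library's ball on 'rV[R]_n, which is for the sup norm. *)
Definition eball (R : realType) (n : nat) (x : 'rV[R]_n) (r : R) : set 'rV[R]_n :=
  [set y | Num.sqrt (\sum_(i < n) (y ord0 i - x ord0 i) ^+ 2) < r].

Definition choquet_avg (R : realType) (n : nat) (delta : R)
    (f : 'rV[R]_n -> \bar R) (x : 'rV[R]_n) (r : R) : \bar R :=
  ((content delta (eball x r))^-1 * choquet delta (eball x r) f)%E.

(* Main.v *)
Require Import Defs.
From mathcomp Require Import measurable_realfun finmap ring lra zify.

(* Write H for the content and g = |f - phi| with phi continuous and int g small.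
   Adding a constant to an integrand is harmless for averages over balls, so near
   x the average of |f - f(x)| is controlled by that of g, by g(x) and by the
   oscillation of phi; hence everything follows from a weak type estimate for the
   maximal function of g, for which countable subadditivity of H is enough. Cover
   the level sets {g > lam 2^j} by dyadic cubes, and put the mass lam 2^j l(Q)^delta
   on each cube Q of the j-th cover; the total mass is at most a multiple of int g.
   Discard the points close to a cube of some cover, or close to a dyadic cube P of
   side at most 1 whose mass exceeds tau l(P)^delta. The maximal such P are disjoint,
   so the discarded set has content O(int g / lam). At any other point, the cubes
   meeting a small ball are smaller than the ball and lie in boundedly many dyadic
   cubes of comparable size and small mass. The comparison H(B(x, r)) >= c r^delta
   is where delta <= n and compactness come in. *)

(** * Sums of nonnegative families *)

Section esum_complements.
Context {R : realType}.
Local Open Scope ereal_scope.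

Lemma subset_esum (T : choiceType) (A B : set T) (a : T -> \bar R) :
  A `<=` B -> \esum_(i in A) a i <= \esum_(i in B) a i.
Proof.
move=> AB; apply: ereal_sup_le => _ [X [fX XA] <-].
by exists X => //; split=> //; exact: subset_trans AB.
Qed.

(** The sets may overlap. Choosing one index [c t] for each [t] of the union embeds the union into
    the disjoint sum by [t -> (c t, t)]. *)
Lemma esum_bigcup_le (I T : choiceType) (A : set I) (D : I -> set T)
    (a : T -> \bar R) : (forall t, 0 <= a t) ->
  \esum_(t in \bigcup_(i in A) D i) a t <= \esum_(i in A) \esum_(t in D i) a t.
Proof.
move=> a0; rewrite esum_esum//.
have [->|/set0P[t0 [i0 _ _]]] := eqVneq (\bigcup_(i in A) D i) set0.
  by rewrite esum_set0 esum_ge0.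
pose c t := xget i0 [set i | A i /\ D i t].
have cP t : (\bigcup_(i in A) D i) t -> A (c t) /\ D (c t) t.
  by move=> [i Ai Dit]; apply: (@xgetPex _ i0 [set i | A i /\ D i t]); exists i.
pose e t := (c t, t).
rewrite -(@esum_image _ _ _ _ e (fun k => a k.2)); last by move=> s t _ _ [].
by apply: subset_esum => _ [t /cP[Ac Dc] <-].
Qed.

Lemma esumZl (T : choiceType) (A : set T) (r : R) (a : T -> \bar R) :
  (0 < r)%R -> (forall t, 0 <= a t) ->
  \esum_(t in A) (r%:E * a t) = r%:E * \esum_(t in A) a t.
Proof.
(* This inequality for every positive factor is enough: used with [r^-1], it gives the converse one
   for [r]. *)
have le (s : R) (b : T -> \bar R) : (0 < s)%R -> (forall t, 0 <= b t) ->
    \esum_(t in A) (s%:E * b t) <= s%:E * \esum_(t in A) b t.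
  move=> s0 b0; apply: ge_ereal_sup => _ [X [fX XA] <-].
  rewrite -ge0_mule_fsumr// lee_wpmul2l//; first by rewrite lee_fin ltW.
  by apply: ereal_sup_ubound; exists X.
move=> r0 a0; apply/eqP; rewrite eq_le le//=.
have ra0 t : 0 <= r%:E * a t by rewrite mule_ge0// lee_fin ltW.
have ri0 : (0 < r^-1)%R by rewrite invr_gt0.
rewrite -[leRHS]mul1e -(@divff _ r) ?gt_eqF// EFinM -muleA.
rewrite lee_wpmul2l//; first by rewrite lee_fin ltW.
apply: le_trans (le _ _ ri0 ra0); apply: le_esum => t _.
by rewrite muleA -EFinM mulVf ?gt_eqF// mul1e.
Qed.

Lemma esum_lt_term (T : choiceType) (A : set T) (a : T -> \bar R) (y : \bar R) :
  (forall t, 0 <= a t) -> \esum_(t in A) a t < y ->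
  forall t, A t -> a t < y.
Proof.
move=> a0; apply: contraPP => /existsNP[t /not_implyP[At /negP]].
rewrite -leNgt => yt; apply/negP; rewrite -leNgt.
by rewrite (le_trans yt)// -[leLHS]esum_set1//; apply: subset_esum => _ ->.
Qed.

End esum_complements.

(** * Dyadic cubes *)

Section dyadic_geometry.
Context {R : realType} {n : nat}.
Implicit Types (x y : 'rV[R]_n) (p q : dyadic n) (k : int) (a d : nat).

(** The pair [(k, dyadic_index k x)] is the cube of side $2^k$ containing [x]. Questions about
    nesting and adjacency of cubes become arithmetic on these integers. *)
Definition dyadic_index k x : 'rV[int]_n := \row_i Num.floor (x ord0 i / 2 ^ k).

Definition corner q : 'rV[R]_n := \row_i ((q.2 ord0 i)%:~R * side R q).

Definition neighbors a q : set (dyadic n) :=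
  [set p : dyadic n | p.1 = q.1 /\ forall i, `|p.2 ord0 i - q.2 ord0 i| <= a%:Z].

(* The union of the (2a+1)^n dyadic cubes of the size of q at distance at most a
   cubes from q. *)
Definition box a q : set 'rV[R]_n :=
  [set x | forall i, `|dyadic_index q.1 x ord0 i - q.2 ord0 i| <= a%:Z].

Lemma exp2z_gt0 k : 0 < 2 ^ k :> R. Proof. by rewrite exprz_gt0. Qed.
Hint Resolve exp2z_gt0 : core.

Lemma side_gt0 q : 0 < side R q. Proof. exact: exp2z_gt0. Qed.
Hint Resolve side_gt0 : core.

Lemma cubeE q x : cube q x <-> dyadic_index q.1 x = q.2.
Proof.
rewrite /cube /=; split=> [qx|<- i].
  by apply/rowP => i; rewrite mxE; apply: floor_def;
    rewrite ler_pdivlMr// ltr_pdivrMr//; exact: qx.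
rewrite mxE; have := floor_itv (x ord0 i / 2 ^ q.1).
by rewrite ler_pdivlMr// ltr_pdivrMr.
Qed.

Lemma cube_corner q : cube q (corner q).
Proof. by move=> i; rewrite mxE lexx ltr_pM2r// ltr_int ltzD1 lexx. Qed.

Lemma dyadic_index_corner q : dyadic_index q.1 (corner q) = q.2.
Proof. exact/cubeE/cube_corner. Qed.

Lemma box_neighbors a q : box a q = \bigcup_(p in neighbors a q) cube p.
Proof.
apply/seteqP; split => [x bx|x [[k m] [/= -> ma] /cubeE/= mx]]; last first.
  by rewrite /box /= mx.
by exists (q.1, dyadic_index q.1 x) => //; apply/cubeE.
Qed.

Lemma cube_box q : cube q = box 0 q.
Proof.
apply/seteqP; split => x; first by move=> /cubeE xq i; rewrite xq subrr normr0.
move=> bx; apply/cubeE/rowP => i; apply/eqP; rewrite -subr_eq0 -normr_le0.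
exact: bx.
Qed.

Lemma dyadic_index_le1 k x y i : `|x ord0 i - y ord0 i| <= 2 ^ k ->
  `|dyadic_index k x ord0 i - dyadic_index k y ord0 i| <= 1.
Proof.
have le (u v : R) : u - v <= 2 ^ k ->
    Num.floor (u / 2 ^ k) - Num.floor (v / 2 ^ k) <= 1.
  move=> uv; rewrite lerBlDr -ltzD1 floor_lt_int ltr_pdivrMr//.
  have := floorD1_gt (v / 2 ^ k); rewrite ltr_pdivrMr// !intrD => H.
  rewrite -addrA mulrDl (le_lt_trans (_ : u <= 2 ^ k + v)) ?lerBlDr//.
    by rewrite -lerBlDr.
  by rewrite mul1r ltrD2l.
rewrite !mxE ler_norml => /andP[h1 h2].
by rewrite ler_norml lerNl opprB !le// -lerN2 opprB.
Qed.

(** For a positive integer $N$, $\lfloor u/N\rfloor$ depends only on $\lfloor u\rfloor$; here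
    $N=2^d$. *)
Lemma dyadic_index_coarse k d x i :
  dyadic_index (k + d%:Z) x ord0 i =
  (dyadic_index k x ord0 i %/ (2 ^ d)%N%:Z)%Z.
Proof.
set N := (2 ^ d)%N%:Z; have N0 : 0 < N by rewrite ltz_nat expn_gt0.
rewrite !mxE; set m := Num.floor (x ord0 i / 2 ^ k).
have := floor_itv (x ord0 i / 2 ^ k); rewrite -/m => /andP[mx xm].
have E : x ord0 i / 2 ^ (k + d%:Z) = x ord0 i / 2 ^ k / N%:~R :> R.
  by rewrite expfzDr// invfM mulrA /N -pmulrn natrX.
rewrite E; apply: floor_def.
rewrite ler_pdivlMr ?ltr0z// ltr_pdivrMr ?ltr0z// -!intrM.
apply/andP; split.
  by rewrite (le_trans _ mx)// ler_int lez_floor// gt_eqF.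
by rewrite (lt_le_trans xm)// ler_int lezD1 ltz_ceil.
Qed.

Lemma dyadic_index_nest j k x y : j <= k ->
  dyadic_index j x = dyadic_index j y -> dyadic_index k x = dyadic_index k y.
Proof.
move=> jk xy; have -> : k = j + `|k - j|%N%:Z by lia.
by apply/rowP => i; rewrite !dyadic_index_coarse xy.
Qed.

(** As $N\ge1$, $u\le v+a<N(\lfloor v/N\rfloor+1)+Na$. *)
Lemma divz_lipschitz (N u v : int) a : 0 < N -> u - v <= a%:Z ->
  (u %/ N)%Z - (v %/ N)%Z <= a%:Z.
Proof.
move=> N0 uv; rewrite lerBlDr -ltzD1 ltz_divLR//.
have := ltz_ceil v N0; nia.
Qed.

Lemma dyadic_index_lipschitz j k x y a : j <= k ->
  (forall i, `|dyadic_index j x ord0 i - dyadic_index j y ord0 i| <= a%:Z) ->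
  (forall i, `|dyadic_index k x ord0 i - dyadic_index k y ord0 i| <= a%:Z).
Proof.
move=> jk xy i; have -> : k = j + `|k - j|%N%:Z by lia.
have N0 : 0 < (2 ^ `|k - j|)%N%:Z by rewrite ltz_nat expn_gt0.
have := xy i; rewrite !dyadic_index_coarse !ler_norml => /andP[h1 h2].
rewrite lerNl opprB !divz_lipschitz//; lia.
Qed.

(** Passing to a coarser scale does not increase distances counted in cubes. Hence a cube may be
    replaced by a dyadic cube containing it without losing any point of its box. *)
Lemma box_nest a p q : p.1 <= q.1 -> dyadic_index q.1 (corner p) = q.2 ->
  box a p `<=` box a q.
Proof.
move=> pq pq2 x px; rewrite /box/= -pq2.
by apply: dyadic_index_lipschitz pq _; rewrite dyadic_index_corner.
Qed.

Lemma sup_nbhs x (e : R) (A : set 'rV[R]_n) : 0 < e ->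
  (forall y, (forall i, `|x ord0 i - y ord0 i| < e) -> A y) -> nbhs x A.
Proof.
move=> e0 eA; apply/nbhs_ballP; exists e => // y xy; apply: eA => i.
by case: xy => _ /(_ ord0 i).
Qed.

(** The content asks for covers whose interior contains the set; one more layer of cubes provides
    this at the cost of a constant factor. *)
Lemma box_interior a q : box a q `<=` interior (box a.+1 q).
Proof.
move=> x qx; apply: (sup_nbhs (exp2z_gt0 q.1)) => y xy i.
have := dyadic_index_le1 (ltW (xy i)); have := qx i; lia.
Qed.

End dyadic_geometry.

(** * Subadditivity of the content *)

Section dyadic_content.
Context {R : realType} {n : nat}.
Variable delta : R.
Implicit Types (E F : set 'rV[R]_n) (p q : dyadic n) (D : set (dyadic n)) (a : nat).
Local Open Scope ereal_scope.

Local Notation w q := ((side R q `^ delta)%:E).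
Local Notation H := (content delta).

Lemma weight_ge0 q : 0 <= w q. Proof. by rewrite lee_fin powR_ge0. Qed.
Hint Resolve weight_ge0 : core.

Lemma content_le_cover E D : E `<=` interior (\bigcup_(q in D) cube q) ->
  H E <= \esum_(q in D) w q.
Proof. by move=> ED; apply: ereal_inf_lbound; exists D. Qed.

Lemma content_ge0 E : 0 <= H E.
Proof. by apply: le_ereal_inf_tmp => _ [D _ <-]; exact: esum_ge0. Qed.
Hint Resolve content_ge0 : core.

Lemma le_content E F : E `<=` F -> H E <= H F.
Proof.
move=> EF; apply: ereal_inf_le_tmp => _ [D /= FD <-].
by exists D => //=; exact: subset_trans FD.
Qed.

Lemma content_lt_cover E (y : \bar R) : H E < y ->
  exists2 D, E `<=` interior (\bigcup_(q in D) cube q) & \esum_(q in D) w q < y.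
Proof. by move=> /ereal_inf_lt[_ [D ED <-]]; exists D. Qed.

Lemma content_bigcup (T : countType) (A : set T) (S : T -> set 'rV[R]_n) :
  H (\bigcup_(i in A) S i) <= \esum_(i in A) H (S i).
Proof.
(* When the sum is finite, so is each [H (S i)], which therefore has a cover exceeding it by at most
   [b i]. *)
have [->|] := eqVneq (\esum_(i in A) H (S i)) +oo; first by rewrite leey.
rewrite -ltey => fin; apply/lee_addgt0Pr => e e0.
pose b (i : T) : \bar R := (e / (2 ^ (choice.pickle i).+1)%:R)%:E.
have b0 i : 0 < b i by rewrite lte_fin divr_gt0// ltr0n expn_gt0.
have /choice[D DP] : forall i, exists D, A i ->
    S i `<=` interior (\bigcup_(q in D) cube q) /\ \esum_(q in D) w q <= H (S i) + b i.
  move=> i; have [Ai|nAi] := pselect (A i); last by exists set0.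
  have Hi : H (S i) \is a fin_num.
    by rewrite ge0_fin_numE// (esum_lt_term _ fin).
  have [|D ED /ltW Db] := @content_lt_cover (S i) (H (S i) + b i).
    by rewrite lteDl.
  by exists D.
pose DD := \bigcup_(i in A) D i.
apply: (@le_trans _ _ (\esum_(q in DD) w q)).
  apply: content_le_cover => x [i Ai Six].
  have [/(_ _ Six) + _] := DP i Ai; apply: interiorS => y [q Dq qy].
  by exists q => //; exists i.
apply: (le_trans (esum_bigcup_le _ _ weight_ge0)).
apply: (@le_trans _ _ (\esum_(i in A) (H (S i) + b i))).
  by apply: le_esum => i /DP[].
rewrite esumD//; last by move=> i _; exact: ltW.
rewrite leeD2l//.
(* The errors are moved to the naturals along the injection [pickle], and the sum is then enlarged
   to all naturals, where it equals [e]. *)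
rewrite -(@esum_image _ _ _ A choice.pickle (fun k => (e / (2 ^ k.+1)%:R)%:E)); last first.
  by move=> i j _ _; exact: (pcan_inj choice.pickleK).
apply: (le_trans (@subset_esum _ _ _ setT _ _)) => //.
rewrite -nneseries_esumT; last by move=> k; rewrite lee_fin divr_ge0// ltW.
exact: (epsilon_trick0 _ (ltW e0)).
Qed.

Lemma content_setU E F : H (E `|` F) <= H E + H F.
Proof.
pose S b := if b then E else F.
have -> : E `|` F = \bigcup_(b in setT) S b.
  apply/seteqP; split => [x [Ex|Fx]|x [[] _]].
  - by exists true.
  - by exists false.
  - by left.
  - by right.
apply: (le_trans (content_bigcup _ _)).
rewrite (esumID [set true])// !setTI esum_set1//.
rewrite (_ : ~` [set true] = [set false]) ?esum_set1//.
by apply/seteqP; split => -[]//= /(_ erefl).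
Qed.

(** The number $(2a+1)^n$, as the cardinal of the type that enumerates neighbors in [shift]. *)
Definition nbox a : R := #|{ffun 'I_n -> 'I_(a + a).+1}|%:R.

Lemma nbox_gt0 a : (0 < nbox a)%R.
Proof. by rewrite ltr0n card_ffun !card_ord expn_gt0. Qed.

Definition shift a q (v : {ffun 'I_n -> 'I_(a + a).+1}) : dyadic n :=
  (q.1, \row_i (q.2 ord0 i - a%:Z + (v i)%:Z)%R).

Lemma neighbors_shift a q : neighbors a q `<=` range (shift (a := a) q).
Proof.
move=> [k m] [/= kq mq].
exists [ffun i => inord (absz (m ord0 i - q.2 ord0 i + a%:Z)%R)] => //.
rewrite /shift kq; congr (_, _).
apply/rowP => i; rewrite mxE ffunE; have := mq i => mqi.
have -> : m 0%R i = m ord0 i by [].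
by rewrite inordK; move: mqi => /=; lia.
Qed.

Lemma finite_neighbors a q : finite_set (neighbors a q).
Proof.
apply: (sub_finite_set (@neighbors_shift a q)).
by apply: finite_image; exact: finite_finset.
Qed.

Lemma esum_neighbors_le a q (h : dyadic n -> \bar R) (c : R) :
  (0 <= c)%R -> (forall p, 0 <= h p) -> (forall p, neighbors a q p -> h p <= c%:E) ->
  \esum_(p in neighbors a q) h p <= (nbox a * c)%:E.
Proof.
move=> c0 h0 hc.
pose t := @shift a q.
have E : neighbors a q = \bigcup_(v in setT) (neighbors a q `&` [set t v]).
  apply/seteqP; split => [p qp|p [v _ []]//].
  by have [v _ vp] := neighbors_shift qp; exists v.
rewrite E; apply: (le_trans (esum_bigcup_le _ _ h0)).
apply: (@le_trans _ _ (\esum_(v in [set: {ffun 'I_n -> 'I_(a + a).+1}]) c%:E)).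
  apply: le_esum => v _.
  have [tv|tv] := pselect (neighbors a q (t v)).
    rewrite setIidr ?esum_set1//; first exact: hc.
    by move=> _ ->.
  rewrite [X in esum X _](_ : _ = set0) ?esum_set0 ?lee_fin//.
  by apply/seteqP; split=> // p [qp] /= pt; apply: tv; rewrite -pt.
apply: ge_ereal_sup => _ [X [fX _] <-].
rewrite fsbig_finite//= sumEFin lee_fin big_const_seq count_predT iter_addr_0 -mulr_natl.
by rewrite ler_wpM2r// ler_nat -(card_uniqP (finmap.fset_uniq _)) max_card.
Qed.

Lemma content_box a q : H (box a q) <= (nbox a.+1 * side R q `^ delta)%:E.
Proof.
apply: (@le_trans _ _ (\esum_(p in neighbors a.+1 q) w p)).
  apply: content_le_cover; rewrite -box_neighbors; exact: box_interior.
apply: esum_neighbors_le => //; first exact: powR_ge0.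
by move=> p [pq _]; rewrite /side pq.
Qed.

Lemma content_bigcup_box a D :
  H (\bigcup_(q in D) box a q) <= (nbox a.+1)%:E * \esum_(q in D) w q.
Proof.
apply: (le_trans (content_bigcup _ _)).
rewrite -esumZl//; last exact: nbox_gt0.
by apply: le_esum => q _; rewrite -EFinM content_box.
Qed.

End dyadic_content.

Arguments nbox R n a : clear implicits.

(** * Lower bounds for the content *)

Lemma dyadic_scale (R : realType) (r : R) : 0 < r ->
  exists k : int, 2 ^ (k - 1) <= r < 2 ^ k.
Proof.
move=> r0; pose m := Num.floor (ln r / ln 2).
have ln2 : 0 < ln 2 :> R by rewrite ln_gt0 ?ltr1n.
have E (k : int) : (2 ^ k : R) = expR (k%:~R * ln 2).
  by rewrite -powR_intmul// /powR pnatr_eq0.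
exists (m + 1); rewrite addrK !E -{1 2}(lnK r0) ler_expR ltr_expR.
by rewrite -ler_pdivlMr// -ltr_pdivrMr// floor_itv.
Qed.

Section content_lower_bound.
Context {R : realType} {n : nat}.
Variable delta : R.
Hypothesis hdelta : 0 < delta <= n%:R.
Implicit Types (p q : dyadic n) (x y : 'rV[R]_n).

Local Notation w q := (side R q `^ delta).
Local Notation H := (content delta).

Let delta_ge0 : 0 <= delta. Proof. by case/andP: hdelta => /ltW. Qed.

Lemma le_weight p q : p.1 <= q.1 -> w p <= w q.
Proof.
move=> pq; apply: ge0_ler_powR; rewrite ?nnegrE ?(ltW (side_gt0 _))//.
by apply: ler_weXz2l => //; rewrite ler1n.
Qed.

(* Unless some cube of F contains p, the cubes of F split among the 2^n children
   of p, each of which they cover; and 2^n 2^(-delta) >= 1. *)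
Lemma finite_dyadic_cover (d : nat) p (F : seq (dyadic n)) :
  (forall q, q \in F -> p.1 - d%:Z <= q.1) ->
  (forall x, cube p x -> exists2 q, q \in F & cube q x) ->
  w p <= \sum_(q <- F) w q.
Proof.
elim: d p F => [|d IH] p F Fd Fp.
  (* At depth 0 no cube of [F] is smaller than [p], so any single one has enough weight. *)
  have [q qF _] := Fp _ (cube_corner p).
  rewrite (big_rem q)//= ler_wpDr ?sumr_ge0//; first by move=> *; exact: powR_ge0.
  by apply: le_weight; have := Fd _ qF; rewrite subr0.
have [/hasP[q qF pq]|/hasPn Flt] := boolP (has (fun q : dyadic n => p.1 <= q.1) F).
  rewrite (big_rem q)//= ler_wpDr ?sumr_ge0//; first by move=> *; exact: powR_ge0.
  exact: le_weight.
pose c (v : {ffun 'I_n -> bool}) : dyadic n :=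
  (p.1 - 1, \row_i (2 * p.2 ord0 i + (v i)%:Z)).
(* Every cube of [F] is now strictly smaller than [p], so it lies in one dyadic cube of the size of
   the children: the one containing its corner. *)
pose Fv v := [seq q <- F | dyadic_index (p.1 - 1) (@corner R n q) == (c v).2].
have cp v : cube (c v) `<=` @cube R n p.
  move=> x /cubeE xv; apply/cubeE/rowP => i.
  have E : p.1 = p.1 - 1 + 1%:Z by rewrite subrK.
  rewrite {1}E dyadic_index_coarse xv mxE.
  have -> : p.2 0 i = p.2 ord0 i by [].
  rewrite expn1; by case: (v i) => /=; lia.
have IHv v : w (c v) <= \sum_(q <- Fv v) w q.
  apply: IH => [q|x xv].
    by rewrite mem_filter => /andP[_ /Fd] /=; lia.
  have [q qF qx] := Fp _ (cp _ _ xv).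
  exists q => //; rewrite mem_filter qF andbT -(iffLR (cubeE _ _) xv).
  apply/eqP; apply: (@dyadic_index_nest _ _ q.1).
    by have := Flt _ qF; rewrite -ltNge /=; lia.
  by rewrite dyadic_index_corner (iffLR (cubeE _ _) qx).
apply: (@le_trans _ _ (\sum_v \sum_(q <- Fv v) w q)); last first.
  (* After exchanging the sums, each [q] is counted at most once, since its corner determines the
     child. *)
  rewrite /Fv; under eq_bigr do rewrite big_filter.
  rewrite (exchange_big_dep xpredT)//=; apply: ler_sum => q _.
  rewrite sumr_const -[leLHS]mulr_natr ler_piMr ?powR_ge0// (ler_nat _ _ 1).
  apply/card_le1_eqP => u v uP vP.
  have /eqP uE : dyadic_index (p.1 - 1) (@corner R n q) == (c u).2 := uP.
  have /eqP vE : dyadic_index (p.1 - 1) (@corner R n q) == (c v).2 := vP.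
  have uv : (c u).2 = (c v).2 by rewrite -uE.
  apply/ffunP => i; have := congr1 (fun M : 'rV[int]_n => M ord0 i) uv; rewrite !mxE.
  by case: (u i); case: (v i) => //; lia.
apply: (@le_trans _ _ (\sum_v w (c v))); last exact: ler_sum.
have -> : w p = 2 `^ delta * (2 ^ (p.1 - 1)) `^ delta.
  rewrite -powRM ?(ltW (exp2z_gt0 _))//.
  by rewrite -[X in X * _]expr1z -expfzDr ?pnatr_eq0// addrC subrK.
rewrite (eq_bigr (fun=> (2 ^ (p.1 - 1)) `^ delta))// sumr_const card_ffun.
rewrite card_bool card_ord -[leRHS]mulr_natl.
rewrite ler_wpM2r ?powR_ge0// natrX -powR_mulrn//.
by apply: ler_powR; [rewrite ler1n|case/andP: hdelta].
Qed.

Definition closed_cube q : set 'rV[R]_n :=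
  [set x | forall i, `[(q.2 ord0 i)%:~R * side R q,
    (q.2 ord0 i + 1)%:~R * side R q]%classic (x ord0 i)].

(** Each cube of a cover is enlarged to the interior of its [box 1], so that compactness leaves
    finitely many. Replacing these by their $3^n$ neighbors gives a finite dyadic cover, whence the
    factor [nbox R n 1]. *)
Lemma content_closed_cube q : (((nbox R n 1)^-1 * w q)%:E <= H (closed_cube q))%E.
Proof.
apply: le_ereal_inf_tmp => _ [D /= QD <-].
have : compact (closed_cube q)
  by apply: (@rV_compact _ _ (fun i => `[(q.2 ord0 i)%:~R * side R q,
    (q.2 ord0 i + 1)%:~R * side R q]%classic)) => i; exact: segment_compact.
rewrite compact_cover.
move=> /(_ _ D (fun p => interior (box 1 p)))[].
- by move=> p _; exact: open_interior.
- move=> x /QD /interior_subset[p Dp px]; exists p => //.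
  by apply: box_interior; rewrite -cube_box.
move=> X XD QX.
pose Y := \bigcup_(p in [set` X]) neighbors 1 p.
have fY : finite_set Y by apply: bigcup_finite => // p _; exact: finite_neighbors.
rewrite EFinM lee_pdivrMl ?nbox_gt0//.
apply: (@le_trans _ _ (\esum_(p in Y) (w p)%:E)%E).
  rewrite esum_fset//; last by move=> *; exact: weight_ge0.
  rewrite fsbig_finite// sumEFin lee_fin.
  pose s : seq (dyadic n) := enum_fset (fset_set Y).
  (* The depth is the largest difference of scale between [q] and a cube of the finite family. *)
  apply: (@finite_dyadic_cover (\max_(p <- s) absz (q.1 - p.1)) q s).
    move=> p ps.
    have := @leq_bigmax_seq _ s xpredT (fun p : dyadic n => absz (q.1 - p.1)) _ ps isT.
    by set M := (\max_(_ <- _) _)%N => /=; lia.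
  move=> x qx; have /QX[p Xp /interior_subset] : closed_cube q x.
    by move=> i; have /andP[h1 h2] := qx i; rewrite /= in_itv/= h1 ltW.
  rewrite box_neighbors => -[p' pp' p'x]; exists p' => //.
  by rewrite /s in_fset_set//; apply/mem_set; exists p.
apply: (le_trans (esum_bigcup_le _ _ (@weight_ge0 _ _ _))).
apply: (@le_trans _ _ (\esum_(p in D) ((nbox R n 1)%:E * (w p)%:E))%E); last first.
  by rewrite esumZl ?nbox_gt0//; exact: weight_ge0.
apply: (@le_trans _ _ (\esum_(p in [set` X]) ((nbox R n 1)%:E * (w p)%:E))%E).
  apply: le_esum => p Xp; rewrite -EFinM; apply: esum_neighbors_le.
  - exact: powR_ge0.
  - exact: weight_ge0.
  - by move=> p' [pp' _]; rewrite /side pp'.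
by apply: subset_esum => p Xp; have /set_mem := XD _ Xp.
Qed.

Lemma eball_dist x y (r : R) : eball x r y -> forall i, `|x ord0 i - y ord0 i| < r.
Proof.
move=> xyr i; apply: le_lt_trans xyr; rewrite distrC -sqrtr_sqr ler_wsqrtr//.
by rewrite (bigD1 i)//= lerDl sumr_ge0// => j _; exact: sqr_ge0.
Qed.

Lemma eball_sub_box x (r : R) (k : int) : r <= 2 ^ k ->
  eball x r `<=` box 1 (k, dyadic_index k x).
Proof.
move=> rk y xy i /=; rewrite distrC; apply: dyadic_index_le1.
by apply: ltW; apply: lt_le_trans rk; exact: eball_dist.
Qed.

(** Coordinates differ by at most $2^k$, so the Euclidean distance is at most $\sqrt n\,2^k\le
    n2^k$. *)
Lemma closed_cube_sub_eball x (r : R) (k : int) : n%:R * 2 ^ k < r ->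
  closed_cube (k, dyadic_index k x) `<=` eball x r.
Proof.
move=> kr y xy; rewrite /eball/=.
have k0 : 0 < 2 ^ k :> R := exp2z_gt0 k.
have r0 : 0 < r by apply: le_lt_trans kr; rewrite mulr_ge0// ltW.
rewrite -(ger0_norm (ltW r0)) -sqrtr_sqr ltr_sqrt ?exprn_gt0//.
apply: (@le_lt_trans _ _ ((n%:R * 2 ^ k) ^+ 2)); last first.
  by rewrite ltr_pXn2r ?nnegrE ?mulr_ge0// ltW.
apply: (@le_trans _ _ (\sum_(i < n) (2 ^ k) ^+ 2)); last first.
  rewrite sumr_const card_ord -[leLHS]mulr_natl exprMn ler_wpM2r ?exprn_ge0 ?(ltW k0)//.
  by rewrite -natrX ler_nat expnS expn1; nia.
apply: ler_sum => i _; rewrite -[leLHS]real_normK ?num_real//.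
rewrite ler_pXn2r ?nnegrE ?(ltW k0)//.
have := xy i; rewrite /= in_itv/= => /andP[h1 h2].
have /(_ i)/andP/=[h3 h4] : cube (k, dyadic_index k x) x by apply/cubeE.
by move: h1 h2 h3 h4; rewrite ler_norml /side/= intrD => *; apply/andP; split; lra.
Qed.

(** The constant of [content_closed_cube] for a cube of side $2^{k-n-1}$. Since $n<2^n$, such a cube
    at the center fits in a ball of radius at least $2^{k-1}$. *)
Definition ball_ratio : R := (nbox R n 1)^-1 * (2 ^ (- n.+1%:Z)) `^ delta.

Lemma ball_ratio_gt0 : 0 < ball_ratio.
Proof. by rewrite mulr_gt0 ?invr_gt0 ?nbox_gt0// powR_gt0// exp2z_gt0. Qed.

Lemma content_eball_ge x (r : R) (k : int) : 2 ^ (k - 1) <= r ->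
  ((ball_ratio * (2 ^ k) `^ delta)%:E <= H (eball x r))%E.
Proof.
move=> kr; pose j := k - n.+1%:Z.
apply: (@le_trans _ _ (H (closed_cube (j, dyadic_index j x)))); last first.
  apply: le_content; apply: closed_cube_sub_eball; apply: lt_le_trans kr.
  have -> : k - 1 = n%:Z + j by rewrite /j; lia.
  rewrite [ltRHS]expfzDr ?pnatr_eq0// ltr_pM2r ?exp2z_gt0//.
  by rewrite -exprnP -natrX ltr_nat ltn_expl.
apply: le_trans (content_closed_cube _).
rewrite lee_fin /ball_ratio -mulrA ler_wpM2l ?invr_ge0 ?(ltW (nbox_gt0 _))//.
by rewrite -powRM ?(ltW (exp2z_gt0 _))// -expfzDr ?pnatr_eq0// addrC.
Qed.

Lemma content_eball_gt0 x (r : R) : 0 < r -> (0 < H (eball x r))%E.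
Proof.
move=> r0; have [k /andP[kr _]] := dyadic_scale r0.
apply: lt_le_trans (content_eball_ge _ kr).
by rewrite lte_fin mulr_gt0 ?ball_ratio_gt0// powR_gt0// exp2z_gt0.
Qed.

Lemma content_eball_lty x (r : R) : 0 < r -> (H (eball x r) < +oo)%E.
Proof.
move=> r0; have [k /andP[_ kr]] := dyadic_scale r0.
apply: (le_lt_trans (le_content _ (eball_sub_box (ltW kr)))).
by apply: le_lt_trans (content_box _ _ _) _; rewrite ltry.
Qed.

Lemma content_eball_fin_num x (r : R) : 0 < r -> H (eball x r) \is a fin_num.
Proof. by move=> r0; rewrite ge0_fin_numE ?content_ge0// content_eball_lty. Qed.

End content_lower_bound.

(** * Choquet integrals and dyadic levels *)

Section integral_of_nonincreasing.
Context {R : realType}.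
Variable F : R -> \bar R.
Hypothesis F_ge0 : forall t, (0 <= F t)%E.
Hypothesis F_noninc : forall s t, s <= t -> (F t <= F s)%E.
Local Notation mu := (@lebesgue_measure R).
Local Open Scope ereal_scope.

(** By monotonicity the preimages of upper rays are intervals. *)
Lemma nonincreasing_emeasurable (D : set R) : measurable D -> measurable_fun D F.
Proof.
move=> mD; apply: (measurability _ (@ErealGenOInfty.measurableE R)).
move=> _ [_ [r ->] <-]; apply: measurableI => //.
apply: is_interval_measurable => s t /=.
rewrite !in_itv/= !andbT => _ Ft u /andP[_ ut].
by rewrite in_itv/= andbT (lt_le_trans Ft)// F_noninc.
Qed.

Let lebesgue_measure_itvco (a b : R) : (a <= b)%R -> mu `[a, b[ = (b - a)%:E.
Proof.
move=> ab; apply: etrans (lebesgue_measure_itv `[a, b[) _ => /=; rewrite lte_fin.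
by case: ltP => // ba; rewrite (le_anti (introT andP (conj ab ba))) subrr.
Qed.

Lemma integral_itv_le (a b : R) : (0 <= a <= b)%R ->
  \int[mu]_(t in `[a, b[) F t <= (b - a)%:E * F a.
Proof.
move=> /andP[a0 ab]; apply: (@le_trans _ _ (\int[mu]_(t in `[a, b[) cst (F a) t)).
  apply: ge0_le_integral => //; first exact: nonincreasing_emeasurable.
  by move=> t /=; rewrite in_itv/= => /andP[+ _]; exact: F_noninc.
by rewrite integral_cst//= lebesgue_measure_itvco// muleC.
Qed.

Lemma integral_itv_ge (a b : R) : (0 <= a <= b)%R ->
  (b - a)%:E * F b <= \int[mu]_(t in `[a, b[) F t.
Proof.
move=> /andP[a0 ab]; apply: (@le_trans _ _ (\int[mu]_(t in `[a, b[) cst (F b) t)).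
  by rewrite integral_cst//= lebesgue_measure_itvco// muleC.
apply: ge0_le_integral => //; first by move=> t _; exact: F_ge0.
  exact: nonincreasing_emeasurable.
by move=> t /=; rewrite in_itv/= => /andP[_ /ltW]; exact: F_noninc.
Qed.

Lemma integral_chebyshev (t : R) : (0 <= t)%R ->
  t%:E * F t <= \int[mu]_(u in `[0%R, +oo[) F u.
Proof.
move=> t0; rewrite -{1}[t]subr0; apply: le_trans (integral_itv_ge _) _.
  by rewrite lexx.
apply: ge0_subset_integral => //; first exact: nonincreasing_emeasurable.
by move=> u /=; rewrite !in_itv/= andbT => /andP[].
Qed.

Lemma integral_dyadic_levels (s : R) : (0 < s)%R ->
  \int[mu]_(t in `[0%R, +oo[) F t = \int[mu]_(t in `[0%R, s[) F t +
    \esum_(j in [set: nat]) \int[mu]_(t in `[(s * 2 ^+ j)%R, (s * 2 ^+ j.+1)%R[) F t.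
Proof.
move=> s0; pose a j := (s * 2 ^+ j)%R.
(* The index is shifted by one: [I 0] is $[0,s)$ and [I j.+1] is $[s2^j,s2^{j+1})$. *)
pose I j := `[(if j is i.+1 then a i else 0)%R, a j[%classic.
have a_gt0 j : (0 < a j)%R by rewrite mulr_gt0// exprn_gt0.
have a_le i j : (i <= j)%N -> (a i <= a j)%R.
  by move=> ij; rewrite ler_pM2l// ler_eXn2l// ltr1n.
have IE : `[0%R, +oo[%classic = \bigcup_j I j.
  apply/seteqP; split => t /=.
    rewrite in_itv/= andbT => t0.
    have ex : exists j, (t < a j)%R.
      have [m tm] : exists m, (t / s < 2 ^+ m)%R.
        exists (Num.bound (t / s)); exact: upper_nthrootP.
      by exists m; rewrite /a mulrC -ltr_pdivrMr.
    case: (ex_minnP ex) => j tj jmin; exists j => //; rewrite /I/= in_itv/= tj andbT.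
    case: j {tj} jmin => // j jmin; rewrite leNgt; apply/negP => /jmin.
    by rewrite ltnn.
  move=> [j _]; rewrite /I/= !in_itv/= andbT => /andP[+ _].
  by case: j => // j; apply: le_trans; exact: ltW.
have tI : trivIset setT I.
  apply: ltn_trivIset => i j ij; apply/seteqP; split => // t [].
  rewrite /I/= !in_itv/= => /andP[_ ti] /andP[jt _].
  case: i ij jt => // i; rewrite ltnS => ji; rewrite leNgt (lt_le_trans ti)//.
  exact: a_le.
rewrite IE (@ge0_integral_bigcup _ _ _ mu I)//; last 2 first.
- by move=> j; exact: measurable_itv.
- by rewrite -IE; exact: nonincreasing_emeasurable.
have I0 j : 0 <= \int[mu]_(t in I j) F t by exact: integral_ge0.
rewrite (nneseries_esumT I0) (@esumID _ _ [set 0%N] _ _ (fun j _ => I0 j)) !setTI.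
rewrite (@esum_set1 _ _ 0%N (fun j => \int[mu]_(t in I j) F t) (I0 0%N)) {1}/I {1}/a expr0 mulr1; congr (_ + _).
have -> : ~` [set 0%N] = succn @` setT.
  apply/seteqP; split => [[|j]//= _|_ [j _ <-]//]; by exists j.
by rewrite esum_image// => i j _ _ [].
Qed.

Lemma integral_le_dyadic_levels (s : R) : (0 < s)%R ->
  \int[mu]_(t in `[0%R, +oo[) F t <= s%:E * F 0 +
    \esum_(j in [set: nat]) (s * 2 ^+ j)%:E * F (s * 2 ^+ j)%R.
Proof.
move=> s0; rewrite (integral_dyadic_levels s0) leeD//.
  by rewrite -{2}[s]subr0 integral_itv_le// lexx ltW.
apply: le_esum => j _; have a0 : (0 < s * 2 ^+ j)%R by rewrite mulr_gt0// exprn_gt0.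
apply: le_trans (integral_itv_le _) _.
  by rewrite (ltW a0) exprS mulrCA ler_pMl// ler1n.
by rewrite exprS mulrCA mulrDl mul1r addrK.
Qed.

(** The integral over $[s2^j,s2^{j+1})$ is at least $s2^jF(s2^{j+1})$, half of the term of index
    $j+1$; the interval $[0,s)$ pays for the term of index 0. *)
Lemma dyadic_levels_le_integral (s : R) : (0 < s)%R ->
  \esum_(j in [set: nat]) (s * 2 ^+ j)%:E * F (s * 2 ^+ j)%R <=
  2%:E * \int[mu]_(t in `[0%R, +oo[) F t.
Proof.
move=> s0; pose u j := (s * 2 ^+ j)%:E * F (s * 2 ^+ j)%R.
have a0 j : (0 < s * 2 ^+ j)%R by rewrite mulr_gt0// exprn_gt0.
have u0 j : 0 <= u j by rewrite mule_ge0// lee_fin ltW.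
rewrite (integral_dyadic_levels s0) ge0_muleDr ?integral_ge0//; last first.
  by apply: esum_ge0 => j _; exact: integral_ge0.
rewrite (esumID [set 0%N] _ u)// !setTI esum_set1//; apply: leeD.
  rewrite /u expr0 mulr1; apply: (@le_trans _ _ (s%:E * F s)) => //.
  have := @integral_itv_ge 0 s; rewrite lexx ltW//= subr0 => /(_ isT) h.
  apply: le_trans h _; rewrite -[leLHS]mul1e lee_wpmul2r ?integral_ge0// lee_fin.
  by rewrite ler1n.
have -> : ~` [set 0%N] = succn @` setT.
  apply/seteqP; split => [[|j]//= _|_ [j _ <-]//]; by exists j.
rewrite esum_image; last by move=> i j _ _ [].
rewrite -esumZl//; last by move=> j; exact: integral_ge0.
apply: le_esum => j _.
have := @integral_itv_ge (s * 2 ^+ j) (s * 2 ^+ j.+1).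
have E : (s * 2 ^+ j.+1 = 2 * (s * 2 ^+ j))%R by rewrite exprS mulrCA.
rewrite (ltW (a0 j)) E ler_pMl// ler1n => /(_ isT).
rewrite mulrDl mul1r addrK => h.
by rewrite /u E EFinM -muleA lee_wpmul2l// mulrDl mul1r.
Qed.

End integral_of_nonincreasing.

(** * The Choquet integral as a sum over dyadic heights *)

Section choquet_integral.
Context {R : realType} {n : nat}.
Variable delta : R.
Implicit Types (Om : set 'rV[R]_n) (g : 'rV[R]_n -> \bar R).
Local Open Scope ereal_scope.
Local Notation H := (content delta).

Definition superlevel Om g (t : R) : set 'rV[R]_n := [set x | Om x /\ t%:E < g x].

Lemma superlevel_noninc Om g s t : (s <= t)%R ->
  superlevel Om g t `<=` superlevel Om g s.
Proof. by move=> st x [Ox tg]; split=> //; rewrite (le_lt_trans _ tg)// lee_fin. Qed.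

Lemma choquet_ge0 Om g : 0 <= choquet delta Om g.
Proof. by apply: integral_ge0 => t _; exact: content_ge0. Qed.

Lemma choquet_chebyshev Om g (t : R) : (0 <= t)%R ->
  t%:E * H (superlevel Om g t) <= choquet delta Om g.
Proof.
apply: (@integral_chebyshev R (fun t => H (superlevel Om g t))).
- by move=> u; exact: content_ge0.
- by move=> u v uv; apply: le_content; exact: superlevel_noninc.
Qed.

(** Heights below [s] cost at most [s%:E * H Om]. This term absorbs additive constants in the
    integrand, so that sublinearity of the Choquet integral is never invoked. *)
Lemma choquet_le_dyadic_levels Om g (s : R) : (0 < s)%R ->
  choquet delta Om g <= s%:E * H Om +
    \esum_(j in [set: nat]) (s * 2 ^+ j)%:E * H (superlevel Om g (s * 2 ^+ j)).
Proof.
move=> s0; apply: le_trans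
  (@integral_le_dyadic_levels R (fun t => H (superlevel Om g t)) _ _ _ s0) _.
- by move=> u; exact: content_ge0.
- by move=> u v uv; apply: le_content; exact: superlevel_noninc.
rewrite leeD2r// lee_wpmul2l ?lee_fin ?(ltW s0)//.
by apply: le_content => x [].
Qed.

Lemma dyadic_levels_le_choquet Om g (s : R) : (0 < s)%R ->
  \esum_(j in [set: nat]) (s * 2 ^+ j)%:E * H (superlevel Om g (s * 2 ^+ j)) <=
  2%:E * choquet delta Om g.
Proof.
apply: (@dyadic_levels_le_integral R (fun t => H (superlevel Om g t))).
- by move=> u; exact: content_ge0.
- by move=> u v uv; apply: le_content; exact: superlevel_noninc.
Qed.

End choquet_integral.

(** * The weak type estimate *)

Section weak_type.
Context {R : realType} {n : nat}.
Variable delta : R.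
Hypothesis hdelta : 0 < delta <= n%:R.
Implicit Types (p q : dyadic n) (x y : 'rV[R]_n) (g : 'rV[R]_n -> \bar R).
Local Open Scope ereal_scope.

Local Notation w q := ((side R q `^ delta)%:E).
Local Notation H := (content delta).
Local Notation N a := (nbox R n a).

(** This is inclusion of dyadic cubes: a cube no larger than [p] lies in [p] as soon as its corner
    does. *)
Definition inside p : set (dyadic n) :=
  [set q : dyadic n | (q.1 <= p.1)%R /\ dyadic_index p.1 (corner (R := R) q) = p.2].

Lemma inside_nested (q p p' : dyadic n) : inside p q -> inside p' q ->
  (p.1 <= p'.1)%R -> inside p' p.
Proof.
move=> [_ qp] [_ qp'] pp'; split=> //; rewrite -qp'.
by apply: dyadic_index_nest pp' _; rewrite qp dyadic_index_corner.
Qed.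

(** * Maximal dyadic cubes of large mass *)

Section maximal_cubes.
Variables (T : countType) (S : set T) (m : T -> \bar R) (c : T -> dyadic n).
Hypothesis m_ge0 : forall t, 0 <= m t.
Variable tau : R.
Hypothesis tau_gt0 : (0 < tau)%R.

(** Masses sit on items of [T] rather than on cubes, because one cube may occur in the covers of
    several levels. *)
Definition mass p := \esum_(t in S `&` c @^-1` inside p) m t.

(* Only cubes of side at most 1, so that every heavy cube lies in a maximal one. *)
Definition heavy : set (dyadic n) :=
  [set p : dyadic n | (p.1 <= 0)%R /\ tau%:E * w p < mass p].

Definition maximal_heavy : set (dyadic n) :=
  [set p : dyadic n | heavy p /\ forall p', heavy p' -> inside p' p -> (p'.1 <= p.1)%R].

(** Scales of heavy cubes are nonpositive, so passing to a larger heavy cube decreases [absz p.1];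
    the induction is on this number. *)
Lemma heavy_in_maximal p : heavy p -> exists2 p', maximal_heavy p' & inside p' p.
Proof.
have [d] := ubnP (absz p.1); elim: d p => // d IH p pd hp.
have [pmax|] := pselect (forall p', heavy p' -> inside p' p -> (p'.1 <= p.1)%R).
  by exists p => //; split=> //; exact: dyadic_index_corner.
move=> /existsNP[p' /not_implyP[hp' /not_implyP[pp' /negP]]]; rewrite -ltNge => lt.
have [|//|M Mmax p'M] := IH p'.
  by have [h1 _] := hp; have [h2 _] := hp'; move: pd; lia.
exists M => //; split; first by apply: le_trans pp'.1 p'M.1.
rewrite -p'M.2; apply: dyadic_index_nest p'M.1 _.
by rewrite dyadic_index_corner pp'.2.
Qed.

(** Two dyadic cubes containing [q] are nested, and maximality of the smaller forces equal sizes. *)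
Lemma maximal_heavy_eq (q p p' : dyadic n) : maximal_heavy p -> maximal_heavy p' ->
  inside p q -> inside p' q -> p = p'.
Proof.
wlog pp' : p p' / (p.1 <= p'.1)%R.
  move=> hwlog Mp Mp' qp qp'; have /orP[pp'|pp'] := le_total p.1 p'.1.
    exact: hwlog.
  exact/esym/hwlog.
move=> [hp pmax] [hp' _] qp qp'; have ip := inside_nested qp qp' pp'.
have e1 : p.1 = p'.1 by apply/eqP; rewrite eq_le pp' pmax.
have e2 : p.2 = p'.2 by rewrite -ip.2 -e1 dyadic_index_corner.
by rewrite [p]surjective_pairing [p']surjective_pairing e1 e2.
Qed.

(** Each item is counted at most once, as its cube lies in at most one maximal heavy cube. *)
Lemma esum_maximal_heavy : \esum_(p in maximal_heavy) mass p <= \esum_(t in S) m t.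
Proof.
rewrite /mass esum_esum// -(@esum_image _ _ _ _ snd m).
  by apply: subset_esum => _ [[p t] /= [_ [St _]] <-].
move=> [p t] [p' t'] /set_mem/= [Mp [_ tp]] /set_mem/= [Mp' [_ tp']] tt'.
rewrite -tt' in tp' *.
by rewrite (maximal_heavy_eq Mp Mp' tp tp').
Qed.

(** Boxes of heavy cubes lie in boxes of maximal ones; the latter satisfy [w p <= mass p / tau], and
    their masses add up to at most the total. *)
Lemma content_heavy a :
  H (\bigcup_(p in heavy) box a p) <= (N a.+1 / tau)%:E * \esum_(t in S) m t.
Proof.
apply: (@le_trans _ _ (H (\bigcup_(p in maximal_heavy) box a p))).
  apply: le_content => x [p /heavy_in_maximal[M MM pM] px].
  by exists M => //; apply: box_nest px; [exact: pM.1|exact: pM.2].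
apply: (le_trans (content_bigcup_box _ _ _)).
rewrite EFinM -muleA lee_wpmul2l ?lee_fin ?(ltW (nbox_gt0 _))//.
apply: (@le_trans _ _ (\esum_(p in maximal_heavy) (tau^-1%:E * mass p))).
  apply: le_esum => p [[_ /ltW hp] _].
  by rewrite lee_pdivlMl.
have mass_ge0 p : 0 <= mass p by exact: esum_ge0.
rewrite esumZl ?invr_gt0// lee_wpmul2l ?lee_fin ?invr_ge0 ?(ltW tau_gt0)//.
exact: esum_maximal_heavy.
Qed.

End maximal_cubes.

(** Consequently all cubes of side at most $2^k$ that meet a small ball about [x] are contained in
    the $3^n$ dyadic cubes of side $2^k$ around [x]. *)
Lemma touching_inside x y q (k : int) : (q.1 <= k)%R -> cube q y ->
  (forall i, (`|x ord0 i - y ord0 i| <= 2 ^ k)%R) ->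
  inside (k, dyadic_index k y) q /\
  neighbors 1 (k, dyadic_index k x) (k, dyadic_index k y).
Proof.
move=> qk /cubeE yq xy; split.
  by split=> //=; apply: dyadic_index_nest qk _; rewrite dyadic_index_corner yq.
by split=> //= i; apply: dyadic_index_le1; rewrite distrC.
Qed.

Definition level (lam : R) (j : nat) : R := (lam * 2 ^+ j)%R.

Lemma level_gt0 lam j : (0 < lam)%R -> (0 < level lam j)%R.
Proof. by move=> l0; rewrite mulr_gt0// exprn_gt0. Qed.

Lemma superlevel_covers g (lam A : R) : (0 < lam)%R -> choquet delta setT g < A%:E ->
  exists D : nat -> set (dyadic n),
    (forall j, superlevel setT g (level lam j) `<=` \bigcup_(q in D j) cube q) /\
    \esum_(t in [set: nat] `*`` D) (level lam t.1)%:E * w t.2 <= (3 * A)%:E.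
Proof.
move=> l0 gA.
have A0 : (0 < A)%R by rewrite -lte_fin; apply: le_lt_trans gA; exact: choquet_ge0.
pose s := level lam; have s0 j : (0 < s j)%R by exact: level_gt0.
pose h j := H (superlevel setT g (s j)).
have sh : \esum_(j in [set: nat]) (s j)%:E * h j < (2 * A)%:E.
  apply: le_lt_trans (dyadic_levels_le_choquet delta setT g l0) _.
  by rewrite EFinM lte_pmul2l.
(* Weighted by [s j], these errors add up to [A]; with the [2 * A] from [sh] this gives the bound
   [3 * A]. *)
pose b j : \bar R := ((A / (2 ^ j.+1)%:R) / s j)%:E.
have b0 j : 0 < b j by rewrite lte_fin !divr_gt0// ltr0n expn_gt0.
have sh0 j : 0 <= (s j)%:E * h j.
  by rewrite mule_ge0 ?content_ge0// lee_fin ltW.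
have /choice[D DP] : forall j, exists D, superlevel setT g (s j) `<=`
    interior (\bigcup_(q in D) cube q) /\ \esum_(q in D) w q <= h j + b j.
  move=> j; have hj : h j \is a fin_num.
    rewrite ge0_fin_numE ?content_ge0//.
    have := esum_lt_term sh0 sh (I : [set: nat] j).
    rewrite -lte_pdivlMl// => /lt_le_trans; apply; exact: leey.
  have [|D ED /ltW Db] :=
      @content_lt_cover _ _ delta (superlevel setT g (s j)) (h j + b j).
    by rewrite lteDl.
  by exists D.
exists D; split.
  by move=> j; apply: subset_trans (DP j).1 _; exact: interior_subset.
rewrite -(@esum_esum _ _ _ setT D (fun j q => (level lam j)%:E * w q)); last first.
  by move=> j q _ _; rewrite mule_ge0 ?weight_ge0// lee_fin ltW.
apply: (@le_trans _ _ (\esum_(j in [set: nat])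
    ((s j)%:E * h j + (A / (2 ^ j.+1)%:R)%:E))).
  apply: le_esum => j _; rewrite esumZl//; last exact: weight_ge0.
  rewrite (_ : (A / _)%:E = (s j)%:E * b j); last first.
    by rewrite -EFinM; congr EFin; rewrite [RHS]mulrC divfK// gt_eqF.
  rewrite -ge0_muleDr ?content_ge0 ?(ltW (b0 j))//.
  by rewrite lee_wpmul2l ?lee_fin ?(ltW (s0 j))//; exact: (DP j).2.
have b'0 j : 0 <= (A / (2 ^ j.+1)%:R)%:E by rewrite lee_fin divr_ge0// ltW.
rewrite esumD// (_ : (3 * A = 2 * A + A)%R); last by ring.
rewrite EFinD leeD ?(ltW sh)// -nneseries_esumT//.
exact: (epsilon_trick0 _ (ltW A0)).
Qed.

(** The sum over levels stands for the part of the integral of [g] above height [lam]. The condition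
    [r < 1] matches the restriction of [heavy] to cubes of side at most 1. *)
Lemma weak_type_bound : exists2 C : R, (0 < C)%R &
  forall g (lam A : R), (0 < lam)%R -> choquet delta setT g < A%:E ->
  exists W : set 'rV[R]_n, H W <= (C * A / lam)%:E /\
    forall x, ~ W x -> forall r : R, (0 < r < 1)%R ->
      \esum_(j in [set: nat])
        (level lam j)%:E * H (superlevel (eball x r) g (level lam j)) <=
      lam%:E * H (eball x r).
Proof.
have br0 : (0 < @ball_ratio R n delta)%R := ball_ratio_gt0 delta.
have N0 a : (0 < N a)%R := nbox_gt0 a.
exists (3 * N 2 * (1 + N 1 ^+ 2 / @ball_ratio R n delta))%R.
  by rewrite !mulr_gt0// addr_gt0// divr_gt0// exprn_gt0.
move=> g lam A l0 gA; have [D [gD DA]] := superlevel_covers l0 gA.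
pose m (t : nat * dyadic n) := (level lam t.1)%:E * w t.2.
have m0 t : 0 <= m t by rewrite mule_ge0 ?weight_ge0// lee_fin ltW// level_gt0.
pose S : set (nat * dyadic n) := [set: nat] `*`` D.
(* One factor [N 1] pays for covering by boxes with interior, the other for the number of neighbors
   of a cube. *)
pose tau := (lam * @ball_ratio R n delta / N 1 ^+ 2)%R.
have tau0 : (0 < tau)%R by apply: divr_gt0; [exact: mulr_gt0|exact: exprn_gt0].
pose U := \bigcup_(t in S) box (R := R) 1 t.2.
pose V := \bigcup_(p in heavy S m snd tau) box (R := R) 1 p.
have HU : H U <= (N 2 / lam * (3 * A))%:E.
  apply: (le_trans (content_bigcup _ _ _)).
  (* All levels are at least [lam], so the weight of a cube is at most its mass divided by [lam]. *)
  apply: (@le_trans _ _ (\esum_(t in S) (N 2 / lam)%:E * m t)).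
    apply: le_esum => t _; apply: (le_trans (content_box _ _ _)).
    rewrite /m -!EFinM lee_fin -!mulrA ler_wpM2l ?(ltW (N0 _))//.
    rewrite /level !mulrA mulVf ?gt_eqF// mul1r ler_peMl ?powR_ge0//.
    by rewrite exprn_ege1// ler1n.
  rewrite esumZl ?divr_gt0// [leRHS]EFinM lee_wpmul2l// lee_fin.
  by rewrite divr_ge0// ltW.
have HV : H V <= (N 2 / tau * (3 * A))%:E.
  apply: (le_trans (content_heavy _ _ _ _ _)) => //.
  by rewrite [leRHS]EFinM lee_wpmul2l// lee_fin divr_ge0// ltW.
exists (U `|` V); split.
  apply: (le_trans (content_setU _ _ _)); apply: (le_trans (leeD HU HV)).
  rewrite -EFinD lee_fin le_eqVlt; apply/orP; left; apply/eqP.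
  rewrite /tau; field.
  by apply/and3P; split; apply: lt0r_neq0 => //; exact: (N0 1%N).
move=> x /not_orP[xU xV] r /andP[r0 r1].
have [k /andP[kr rk]] := dyadic_scale r0.
have k0 : (k <= 0)%R.
  have : (2 ^ (k - 1) < 2 ^ 0 :> R)%R by apply: le_lt_trans kr _.
  by rewrite ltr_eXz2l ?(ltr1n _ 2)// ltrBlDr ltzD1.
pose meets (q : dyadic n) := cube q `&` eball x r !=set0.
pose P x := (k, dyadic_index k x).
(* If a cube of some cover larger than $2^k$ met the ball, [x] would lie in its [box 1], hence in
   [U]. *)
have small t : S t -> meets t.2 -> exists2 p, neighbors 1 (P x) p & inside p t.2.
  case: t => j q St [y [/= qy xy]].
  have dxy := eball_dist xy.
  have qk : (q.1 <= k)%R.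
    rewrite leNgt; apply/negP => kq; apply: xU; exists (j, q) => // i /=.
    rewrite -(iffLR (cubeE _ _) qy); apply: dyadic_index_le1.
    apply: ltW; apply: lt_le_trans (dxy i) _; apply: le_trans (ltW rk) _.
    by apply: ler_weXz2l; [rewrite ler1n|exact: ltW].
  have [|h1 h2] := @touching_inside x y q k qk qy.
    by move=> i; apply: ltW; apply: lt_trans (dxy i) rk.
  by exists (P y).
(* A heavy cube adjacent to the one containing [x] would put [x] in [V]. *)
have light p : neighbors 1 (P x) p -> mass S m snd p <= (tau * (2 ^ k) `^ delta)%:E.
  move=> [pk px]; rewrite leNgt; apply/negP => hp; apply: xV; exists p => //.
    by split; [rewrite pk|rewrite /side pk].
  by move=> i; rewrite pk distrC; exact: px.
apply: (@le_trans _ _ (\esum_(j in [set: nat]) (N 1)%:E *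
    \esum_(q in D j `&` meets) m (j, q))).
  apply: le_esum => j _; rewrite -esumZl// /m/=.
  apply: (@le_trans _ _ ((level lam j)%:E * ((N 1)%:E * \esum_(q in D j `&` meets) w q))).
    rewrite lee_wpmul2l ?lee_fin ?(ltW (level_gt0 _ _))//.
    apply: le_trans (content_bigcup_box delta 0 (D j `&` meets)).
    apply: le_content => y [xy gy].
    have [q Dq qy] := gD j y (conj I gy).
    by exists q; [split=> //; exists y|rewrite -cube_box].
  rewrite -esumZl//; last exact: weight_ge0.
  rewrite -esumZl ?level_gt0//; last first.
    by move=> q; rewrite mule_ge0 ?weight_ge0// lee_fin ltW.
  by apply: le_esum => q _; rewrite muleCA.
rewrite esumZl//; last by move=> j; exact: esum_ge0.
rewrite (@esum_esum _ _ _ setT (fun j => D j `&` meets) (fun j q => m (j, q)))//.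
(* All levels together are regrouped according to the neighbor that contains the cube. *)
apply: (@le_trans _ _ ((N 1)%:E * \esum_(p in neighbors 1 (P x)) mass S m snd p)).
  rewrite lee_wpmul2l ?lee_fin ?(ltW (N0 _))//.
  apply: le_trans (esum_bigcup_le _ (fun p => S `&` snd @^-1` inside p) m0).
  rewrite (eq_esum (b := m)); last by move=> [].
  apply: subset_esum => -[j q] [_ /= [Dq mq]].
  have St : S (j, q) by [].
  by have [p Pp pq] := small _ St mq; exists p.
apply: (@le_trans _ _ ((N 1)%:E * (N 1 * (tau * (2 ^ k) `^ delta))%:E)).
  rewrite lee_wpmul2l ?lee_fin ?(ltW (N0 _))//.
  apply: esum_neighbors_le => //.
  - by rewrite mulr_ge0 ?powR_ge0// ltW.
  - by move=> p; exact: esum_ge0.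
apply: (@le_trans _ _ (lam%:E * (@ball_ratio R n delta * (2 ^ k) `^ delta)%:E)); last first.
  by rewrite lee_wpmul2l ?lee_fin ?(ltW l0)//; exact: content_eball_ge.
rewrite -!EFinM lee_fin le_eqVlt; apply/orP; left; apply/eqP.
rewrite /tau; field.
by apply: lt0r_neq0; exact: (N0 1%N).
Qed.

End weak_type.

(** * Lebesgue points *)

Lemma limf_esup_near_eq (R : realType) (u : R -> \bar R) (F : set_system R) (c : R) :
  ProperFilter F ->
  (forall e : R, 0 < e ->
    \forall r \near F, ((c - e)%:E <= u r <= (c + e)%:E)%E) ->
  limf_esup u F = c%:E.
Proof.
move=> FF uc; rewrite limf_esupE; apply/eqP; rewrite eq_le; apply/andP; split.
  apply/lee_addgt0Pr => e e0; rewrite -EFinD.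
  apply: (@le_trans _ _ (ereal_sup (u @` [set r | ((c - e)%:E <= u r <= (c + e)%:E)%E]))).
    apply: ereal_inf_lbound; exists [set r | ((c - e)%:E <= u r <= (c + e)%:E)%E] => //.
    exact: uc.
  by apply: ge_ereal_sup => _ [r /andP[_ ur] <-].
apply: le_ereal_inf_tmp => _ [A FA <-]; apply/lee_subgt0Pr => e e0; rewrite -EFinB.
have [r [Ar /andP[ur _]]] := filter_ex (filterI FA (uc _ e0)).
by apply: le_trans ur _; apply: ereal_sup_ubound; exists r.
Qed.

Lemma abse_dist_triangle (R : realType) (u : \bar R) (a b : R) :
  (`|u - a%:E| <= `|u - b%:E| + `|b - a|%:E)%E.
Proof.
case: u => [u| |]//=; rewrite -EFinD lee_fin.
by rewrite (le_trans _ (ler_normD _ _))// addrA subrK.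
Qed.

Section lebesgue_points.
Context {R : realType} {n : nat}.
Variable delta : R.
Hypothesis hdelta : 0 < delta <= n%:R.
Implicit Types (x y : 'rV[R]_n) (f g : 'rV[R]_n -> \bar R).
Local Notation H := (content delta).
Local Open Scope ereal_scope.

Definition oscillation f x : R -> \bar R :=
  fun r => choquet delta (eball x r) (fun y => `|f y - f x|).

Lemma superlevel_chebyshev f (t A : R) : (0 < t)%R ->
  choquet delta setT f <= A%:E -> H (superlevel setT f t) <= (A / t)%:E.
Proof.
move=> t0 fA; rewrite mulrC EFinM lee_pdivlMl//.
exact: le_trans (choquet_chebyshev _ _ _ (ltW t0)) fA.
Qed.

Lemma content_infinite_eq0 f : NL1 delta setT f ->
  H [set x | f x \isn't a fin_num] = 0.
Proof.
rewrite /NL1/= => fI; apply/eqP; rewrite eq_le content_ge0 andbT.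
have I0 := choquet_ge0 delta setT (fun x => `|f x|).
have /fineK IE : choquet delta setT (fun x => `|f x|) \is a fin_num.
  by rewrite ge0_fin_numE.
set I := fine _ in IE; have {}I0 : (0 <= I)%R by rewrite fine_ge0.
apply/lee_addgt0Pr => e e0; rewrite add0e.
(* At this height Chebyshev gives at most $eI/(I+1)\le e$; the added 1 keeps the height positive
   when $I=0$. *)
have t0 : (0 < (I + 1) / e)%R by rewrite divr_gt0// ltr_wpDl.
apply: (@le_trans _ _ (H (superlevel setT (fun x => `|f x|) ((I + 1) / e)))).
  apply: le_content => x /=; rewrite /superlevel/=.
  by case: (f x) => //= _; split=> //; exact: ltry.
apply: le_trans (superlevel_chebyshev t0 _) _.
  by rewrite -IE.
rewrite lee_fin invf_div mulrCA ger_pMr// ler_pdivrMr ?mul1r ?lerDl//.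
by rewrite ltr_wpDl.
Qed.

(** Near [x], $|f(y)-f(x)|\le g(y)+2\lambda$. Where $g\le\lambda2^j$ this is at most $3\lambda2^j$,
    so the level $4\lambda2^j$ of the left side lies in the level $\lambda2^j$ of [g]. Low heights
    and the sum each contribute $4\lambda$. *)
Lemma oscillation_le f (phi : 'rV[R]_n -> R) x (lam : R) :
  (0 < lam)%R -> f x \is a fin_num -> {for x, continuous phi} ->
  let g := fun y => `|f y - (phi y)%:E| in
  g x <= lam%:E ->
  (forall r, (0 < r < 1)%R -> \esum_(j in [set: nat])
      (level lam j)%:E * H (superlevel (eball x r) g (level lam j)) <=
      lam%:E * H (eball x r)) ->
  \forall r \near 0^'+, oscillation f x r <= (8 * lam)%:E * H (eball x r).
Proof.
move=> l0 fx phix g gx gB.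
have [d /= d0 dphi] : exists2 d : R, (0 < d)%R &
    forall y, (forall i, `|x ord0 i - y ord0 i| < d)%R -> (`|phi x - phi y| < lam)%R.
  have /cvgrPdist_lt/(_ _ l0)/nbhs_ballP[d d0 dphi] := phix.
  exists d => // y xy; apply: dphi; split=> // i j.
  by rewrite (ord1 i); exact: xy.
near=> r.
have r0 : (0 < r)%R by near: r; exact: nbhs_right_gt.
have r1 : (r < 1)%R by near: r; exact: nbhs_right_lt.
have rd : (r < d)%R by near: r; exact: nbhs_right_lt.
have fg y : eball x r y -> `|f y - f x| <= g y + (2 * lam)%:E.
  move=> xy; have pxy : (`|phi x - phi y| < lam)%R.
    by apply: dphi => i; apply: lt_trans rd; exact: eball_dist.
  move: gx; rewrite /g -(fineK fx) -EFinB abse_EFin lee_fin => gx.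
  apply: le_trans (abse_dist_triangle _ _ (phi y)) _.
  rewrite leeD2l// lee_fin.
  have -> : (phi y - fine (f x) = - (fine (f x) - phi x) - (phi x - phi y))%R by ring.
  apply: le_trans (ler_normB _ _) _; rewrite normrN; lra.
have l4 : (0 < 4 * lam)%R by rewrite mulr_gt0.
apply: le_trans (choquet_le_dyadic_levels delta _ _ l4) _.
have -> : (8 * lam = 4 * lam + 4 * lam)%R by ring.
rewrite EFinD ge0_muleDl ?lee_fin ?(ltW l4)// leeD2l//.
rewrite [leRHS](_ : _ = 4%:E * (lam%:E * H (eball x r))); last by rewrite muleA -EFinM.
apply: (@le_trans _ _ (4%:E * \esum_(j in [set: nat])
    (level lam j)%:E * H (superlevel (eball x r) g (level lam j)))); last first.
  by rewrite lee_wpmul2l ?lee_fin//; apply: gB; rewrite r0 r1.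
rewrite -esumZl//; last first.
  by move=> j; rewrite mule_ge0 ?content_ge0// lee_fin ltW// level_gt0.
apply: le_esum => j _; rewrite muleA -EFinM /level -mulrA.
rewrite lee_wpmul2l//; first by rewrite lee_fin !mulr_ge0// ?exprn_ge0// ltW.
apply: le_content => y [xy fy]; split=> //.
rewrite ltNge; apply/negP => gy; move: fy; apply/negP; rewrite -leNgt.
apply: (le_trans (fg _ xy)); apply: (le_trans (leeD2r _ gy)).
rewrite -EFinD lee_fin.
have : (lam <= lam * 2 ^+ j)%R by rewrite ler_peMr ?(ltW l0)// exprn_ege1// ler1n.
lra.
Unshelve. all: by end_near. Qed.

Lemma content_large_oscillation f (lam : R) : (0 < lam)%R ->
  NL1_limit_of_continuous delta f ->
  H [set x | f x \is a fin_num /\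
    ~ \forall r \near 0^'+, oscillation f x r <= (8 * lam)%:E * H (eball x r)] = 0.
Proof.
move=> l0 [phi [cphi lim]]; apply/eqP; rewrite eq_le content_ge0 andbT.
have [C C0 weak] := weak_type_bound hdelta.
apply/lee_addgt0Pr => e e0; rewrite add0e.
(* The exceptional set [W] and the set where [g] exceeds [lam] have contents at most $CA/\lambda$
   and $A/\lambda$, with sum [e]. *)
pose A := (e * lam / (C + 1))%R.
have C1 : (0 < C + 1)%R by rewrite addr_gt0.
have A0 : (0 < A)%R by rewrite divr_gt0// mulr_gt0.
have [i iA] : exists i, choquet delta setT (fun x => `|f x - (phi i x)%:E|) < A%:E.
  have : \forall i \near \oo, choquet delta setT (fun x => `|f x - (phi i x)%:E|) < A%:E.
    by apply: (lim [set u | u < A%:E]); apply: open_ereal_lt'; rewrite lte_fin.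
  by move=> /filter_ex.
set g := fun x => `|f x - (phi i x)%:E| in iA.
have [W [HW WB]] := weak g lam A l0 iA.
apply: (@le_trans _ _ (H (W `|` superlevel setT g lam))).
  apply: le_content => x [fx noscx]; apply: contrapT => /not_orP[Wx gx].
  apply: noscx; apply: (oscillation_le l0 fx (cphi i x)); last exact: WB.
  by rewrite leNgt; apply/negP => gx'; apply: gx.
apply: (le_trans (content_setU _ _ _)).
apply: (le_trans (leeD HW (superlevel_chebyshev l0 (ltW iA)))).
rewrite -EFinD lee_fin le_eqVlt; apply/orP; left; apply/eqP.
by rewrite /A; field; rewrite !gt_eqF.
Qed.

Lemma lebesgue_points f : NL1 delta setT f -> NL1_limit_of_continuous delta f ->
  content_ae delta (fun x => f x \is a fin_num /\ forall lam : R, (0 < lam)%R ->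
    \forall r \near 0^'+, oscillation f x r <= lam%:E * H (eball x r)).
Proof.
move=> fI flim.
pose b (m : nat) : R := (m.+1%:R^-1)%R.
pose E m := [set x | f x \is a fin_num /\
  ~ \forall r \near 0^'+, oscillation f x r <= (8 * b m)%:E * H (eball x r)].
pose I := [set x | f x \isn't a fin_num].
exists (I `|` \bigcup_(m in [set: nat]) E m); split.
  apply/eqP; rewrite eq_le content_ge0 andbT.
  apply: (le_trans (content_setU _ _ _)); rewrite content_infinite_eq0// add0e.
  apply: (le_trans (content_bigcup _ _ _)); rewrite esum1// => m _.
  by apply: content_large_oscillation => //; rewrite invr_gt0 ltr0n.
move=> x /not_orP[/negP/negPn fx Ex]; split=> // lam l0.
have [m bm] : exists m, (8 * b m <= lam)%R.
  exists (Num.bound (8 / lam)); rewrite /b ler_pdivrMr ?ltr0n// mulrC -ler_pdivrMr//.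
  apply: ltW; apply: (lt_le_trans (archi_boundP _)); last by rewrite ler_nat.
  by rewrite divr_ge0// ltW.
have : \forall r \near 0^'+, oscillation f x r <= (8 * b m)%:E * H (eball x r).
  by apply: contrapT => nE; apply: Ex; exists m.
apply: filterS => r /le_trans; apply; rewrite lee_wpmul2r ?content_ge0//.
Qed.

Lemma choquet_avg_bounds f x (r a b : R) : (0 < r)%R ->
  a%:E * H (eball x r) <= choquet delta (eball x r) f <= b%:E * H (eball x r) ->
  a%:E <= choquet_avg delta f x r <= b%:E.
Proof.
move=> r0; rewrite /choquet_avg.
have := content_eball_gt0 hdelta x r0; have := content_eball_fin_num delta x r0.
move=> /fineK <-; set h := fine _; rewrite lte_fin => h0.
rewrite inver gt_eqF// lee_pdivlMl// lee_pdivrMl//.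
by rewrite !(muleC h%:E).
Qed.

(** If $f(y)>(c+e/2)2^j$, then $|f(y)-c|>(e/2)2^j$ because $c\le c2^j$. So the levels of [f] above
    $c+e/2$ are controlled by the oscillation. *)
Lemma choquet_eball_le f x (c e : R) : (0 < e)%R -> (0 <= c)%R -> f x = c%:E ->
  (forall lam : R, (0 < lam)%R ->
    \forall r \near 0^'+, oscillation f x r <= lam%:E * H (eball x r)) ->
  \forall r \near 0^'+, choquet delta (eball x r) f <= (c + e)%:E * H (eball x r).
Proof.
move=> e0 c0 fx osc; pose e2 := (e / 2)%R; pose s := (c + e2)%R.
have e20 : (0 < e2)%R by rewrite divr_gt0.
have s0 : (0 < s)%R by rewrite ltr_wpDl.
(* Passing between the two families of levels costs $2s/e_2$, which turns this bound into $e_2$. *)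
have l0 : (0 < e2 * e2 / (2 * s))%R by rewrite !(divr_gt0, mulr_gt0).
apply: filterS (osc _ l0) => r oscr.
apply: le_trans (choquet_le_dyadic_levels delta _ _ s0) _.
have -> : (c + e = s + e2)%R by rewrite /s /e2; field.
rewrite [(s + e2)%:E]EFinD ge0_muleDl ?lee_fin ?(ltW s0) ?(ltW e20)// leeD2l//.
pose g y := `|f y - f x|.
apply: (@le_trans _ _ ((s / e2)%:E * \esum_(j in [set: nat])
    (e2 * 2 ^+ j)%:E * H (superlevel (eball x r) g (e2 * 2 ^+ j)))).
  rewrite -esumZl ?divr_gt0//; last first.
    by move=> j; rewrite mule_ge0 ?content_ge0// lee_fin mulr_ge0 ?exprn_ge0// ltW.
  apply: le_esum => j _; rewrite muleA -EFinM mulrA divfK ?gt_eqF//.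
  rewrite lee_wpmul2l//; first by rewrite lee_fin mulr_ge0 ?exprn_ge0// ltW.
  apply: le_content => y [xy fy]; split=> //; rewrite /g fx.
  move: fy; case: (f y) => [v| |]//=; last by move=> _; exact: ltry.
  rewrite !lte_fin /s mulrDl => fy.
  have : (c <= c * 2 ^+ j)%R by rewrite ler_peMr// exprn_ege1// ler1n.
  move: (ler_norm (v - c)%R); lra.
apply: (@le_trans _ _ ((s / e2)%:E * (2%:E * oscillation f x r))).
  apply: lee_wpmul2l (dyadic_levels_le_choquet _ _ _ e20).
  by rewrite lee_fin ltW// divr_gt0.
apply: (@le_trans _ _ ((s / e2 * 2)%:E * ((e2 * e2 / (2 * s))%:E * H (eball x r)))).
  rewrite muleA -EFinM lee_wpmul2l// lee_fin ltW// mulr_gt0// divr_gt0//.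
rewrite muleA -EFinM lee_wpmul2r ?content_ge0// lee_fin le_eqVlt.
apply/orP; left; apply/eqP; field.
by rewrite !gt_eqF.
Qed.

(** A single level suffices: the ball is covered by the set where $f>c-e/2$ and the set where the
    oscillation exceeds $e/4$. Chebyshev bounds the first by the integral of [f] and the second by
    the oscillation. *)
Lemma choquet_eball_ge f x (c e : R) : (0 < e)%R -> (0 <= c)%R -> f x = c%:E ->
  (forall lam : R, (0 < lam)%R ->
    \forall r \near 0^'+, oscillation f x r <= lam%:E * H (eball x r)) ->
  \forall r \near 0^'+, (c - e)%:E * H (eball x r) <= choquet delta (eball x r) f.
Proof.
move=> e0 c0 fx osc; pose e2 := (e / 2)%R; pose t := (c - e2)%R.
have e20 : (0 < e2)%R by rewrite divr_gt0.
have [t0|t0] := ltP t 0%R.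
  apply: nearW => r; apply: (@le_trans _ _ 0); last exact: choquet_ge0.
  rewrite mule_le0_ge0 ?content_ge0// lee_fin.
  by move: t0; rewrite /t /e2; lra.
pose e4 := (e2 / 2)%R; have e40 : (0 < e4)%R by rewrite divr_gt0.
(* Multiplied by $t/e_4$ this is at most $e_2$; the denominator $t+1$ allows $t=0$. *)
have l0 : (0 < e2 * e4 / (t + 1))%R.
  by apply: divr_gt0; [exact: mulr_gt0|rewrite ltr_wpDl].
near=> r.
have r0 : (0 < r)%R by near: r; exact: nbhs_right_gt.
have oscr : oscillation f x r <= (e2 * e4 / (t + 1))%:E * H (eball x r).
  by near: r; exact: osc.
pose g y := `|f y - f x|.
pose H1 := H (superlevel (eball x r) f t).
pose H2 := H (superlevel (eball x r) g e4).
have cover : H (eball x r) <= H1 + H2.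
  apply: le_trans (content_setU _ _ _); apply: le_content => y xy.
  have [fy|fy] := ltP t%:E (f y); [by left|right; split=> //].
  rewrite /g fx; move: fy; case: (f y) => [v| |]//=; last by move=> _; exact: ltry.
  rewrite lee_fin lte_fin /t => fy.
  by move: (ler_norm (- (v - c))%R); rewrite normrN /e4; lra.
have h1 : t%:E * H1 <= choquet delta (eball x r) f := choquet_chebyshev _ _ _ t0.
have h2 : e4%:E * H2 <= oscillation f x r := choquet_chebyshev _ _ _ (ltW e40).
have {}h2 : t%:E * H2 <= e2%:E * H (eball x r).
  have -> : t%:E * H2 = (t / e4)%:E * (e4%:E * H2) by rewrite muleA -EFinM divfK// gt_eqF.
  have te4 : 0 <= (t / e4)%:E by rewrite lee_fin divr_ge0// ltW.
  apply: (le_trans (lee_wpmul2l te4 (le_trans h2 oscr))).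
  rewrite muleA -EFinM lee_wpmul2r ?content_ge0// lee_fin.
  have -> : (t / e4 * (e2 * e4 / (t + 1)) = e2 * (t / (t + 1)))%R.
    by field; rewrite !gt_eqF// ltr_wpDl.
  by rewrite ger_pMr// ler_pdivrMr ?mul1r ?lerDl// ltr_wpDl.
have hfin := content_eball_fin_num delta x r0.
have -> : (c - e = t - e2)%R by rewrite /t /e2; field.
rewrite EFinB muleBl// leeBlDr ?fin_numM//.
apply: (@le_trans _ _ (t%:E * (H1 + H2))); first by rewrite lee_wpmul2l.
by rewrite ge0_muleDr ?content_ge0// leeD.
Unshelve. all: by end_near. Qed.

End lebesgue_points.

Theorem theorem5p12 (R : realType) (n : nat) (delta : R) (f : 'rV[R]_n -> \bar R)
    (hn : (1 <= n)%N) (hdelta : 0 < delta <= n%:R)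
    (hf : NL1 delta setT f) (hlim : NL1_limit_of_continuous delta f) :
  content_ae delta (fun x : 'rV[R]_n =>
    limf_esup (fun r : R => choquet_avg delta (fun y => `|f y - f x|)%E x r) 0^'+
      = 0%E) /\
  ((forall x, (0 <= f x)%E) ->
   content_ae delta (fun x : 'rV[R]_n =>
     f x = limf_esup (fun r : R => choquet_avg delta f x r) 0^'+)).
Proof.
have [E [E0 EP]] := lebesgue_points hdelta hf hlim.
(* One exceptional set serves both claims, and outside it [f x] is finite. *)
split=> [|f0]; exists E; split=> // x /EP[fx osc].
  apply: limf_esup_near_eq => e e0; near=> r.
  apply: (choquet_avg_bounds hdelta); first by near: r; exact: nbhs_right_gt.
  apply/andP; split; last by rewrite add0r; near: r; exact: osc.
  apply: (@le_trans _ _ 0%E); last exact: choquet_ge0.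
  by rewrite mule_le0_ge0 ?content_ge0// lee_fin sub0r lerNl oppr0 ltW.
have fxE := esym (fineK fx); have c0 : 0 <= fine (f x) by rewrite fine_ge0.
rewrite [LHS]fxE; apply/esym.
apply: limf_esup_near_eq => e e0; near=> r.
apply: (choquet_avg_bounds hdelta); first by near: r; exact: nbhs_right_gt.
apply/andP; split; near: r.
  exact: choquet_eball_ge.
exact: choquet_eball_le.
Unshelve. all: by end_near. Qed.
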